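(* Let $\mathcal{F}=(W,\leq,Y_0)$ be a sub-normal frame. Define relations on $W$, for all $x,y\in W$, by (A) $xR_{N_1}y$ iff $\exists z\in W(x\leq z\ \&\ y\leq z)$; (B) $xR_{N_2}y$ iff $\exists z\in W(x\leq z\ \&\ y\leq z\ \&\ z\notin Y_0)$. Then: 1. $Y_0=\{z\in W: \text{there is no } x\in W \text{ with } zR_{N_2}x\}$. 2. $\Phi(\mathcal{F}):=(W,\leq,R_{N_1},R_{N_2})$ is an $\hat N$-frame. If $\mathcal{F}$ is a sub-normal identity frame, then $\Phi(\mathcal{F})$ is an $\hat N'$-frame. 3. If $v$ is a valuation on $\mathcal{F}$, then $v$ is a valuation on $\Phi(\mathcal{F})$ such that for all $\alpha\in F$ and $x\in W$: (a) $(\mathcal{F},v),x\vDash\alpha\Leftrightarrow(\Phi(\mathcal{F}),v),x\vDash\alpha$; (b) $(\mathcal{F},v)\vDash\alpha\Leftrightarrow(\Phi(\mathcal{F}),v)\vDash\alpha$; (c) $\mathcal{F}\vDash\alpha\Leftrightarrow\Phi(\mathcal{F})\vDash\alpha$.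
   Context: $F$ is the set of formulas built from propositional variables and constants $\top,\bot$ with $\wedge,\vee,\rightarrow,\neg,\sim$. A sub-normal frame is $(W,\leq,Y_0)$ with $(W,\leq)$ a nonempty poset and $Y_0\subseteq W$ an upset such that for all $x\in W$: if for every $y\geq x$ there is $z\geq y$ with $z\in Y_0$, then $x\in Y_0$. It is a sub-normal identity frame if moreover for all $x,y\in W\setminus Y_0$, $x\leq y$ implies $y\leq x$. A strictly condensed $J$-frame is a triple $(X,\leq,R_N)$ with $(X,\leq)$ a poset and $R_N$ a binary relation on $X$ such that: (i) $x\leq x'$, $x'R_Ny'$, $y\leq y'$ imply $xR_Ny$; (ii) $R_N$ is symmetric; (iii) $\forall x,y\,(xR_Ny\Rightarrow\exists z(x\leq z\ \&\ y\leq z\ \&\ xR_Nz))$. It is a strictly condensed $H$-frame if moreover $R_N$ is reflexive. An $\hat N$-frame is $(X,\leq,R_{N_1},R_{N_2})$ such that (1) $(X,\leq,R_{N_1})$ is a strictly condensed $H$-frame; (2) $(X,\leq,R_{N_2})$ is a strictly condensed $J$-frame; (3) for all $x\in X$: if for every $y$ with $xR_{N_1}y$ there is $z$ with $yR_{N_1}z$ and no $z'$ with $zR_{N_2}z'$, then there is no $z''$ with $xR_{N_2}z''$. An $\hat N'$-frame is an $\hat N$-frame such that $xR_{N_2}y$ implies $y\leq x$. On either kind of frame, a valuation assigns an upset to each propositional variable. Truth: variables via $v$; $\top$ everywhere, $\bot$ nowhere; $\wedge,\vee$ pointwise; $x\vDash\alpha\rightarrow\beta$ iff for all $y\geq x$,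 $y\vDash\alpha$ implies $y\vDash\beta$. On sub-normal frames: $x\vDash\neg\alpha$ iff for all $y\geq x$, $y\nvDash\alpha$; $x\vDash\sim\alpha$ iff for all $y\geq x$, $y\vDash\alpha$ implies $y\in Y_0$. On $\hat N$-frames: $x\vDash\neg\alpha$ iff for all $y$, $xR_{N_1}y$ implies $y\nvDash\alpha$; $x\vDash\sim\alpha$ iff for all $y$, $xR_{N_2}y$ implies $y\nvDash\alpha$. $(\mathcal{F},v)\vDash\alpha$ means truth at all points; $\mathcal{F}\vDash\alpha$ means truth at all points under all valuations. *)

(* Defs.v *)
From Stdlib Require Import Relations.

Set Implicit Arguments.
Unset Strict Implicit.
Unset Printing Implicit Defensive.

Inductive formula (V : Type) : Type :=
| Var (p : V)
| Top
| Bot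
| And (a b : formula V)
| Or (a b : formula V)
| Imp (a b : formula V)
| Neg (a : formula V)   (* the connective written ¬ *)
| Sim (a : formula V).  (* the connective written ∼ *)

Arguments Top {V}.
Arguments Bot {V}.

Definition upset (W : Type) (le : relation W) (A : W -> Prop) : Prop :=
  forall x y, le x y -> A x -> A y.

Definition valuation (V W : Type) (le : relation W) (v : V -> W -> Prop) : Prop :=
  forall p, upset le (v p).

(** The records [sn_structure] and [nn_structure] carry only data; the frame
    conditions are the predicates [subnormal_frame], [subnormal_identity_frame],
    [Nhat_frame] and [Nhat'_frame] on them. *)

Record sn_structure : Type := SnStructure {
  sn_pt :> Type;
  sn_le : relation sn_pt;
  sn_Y0 : sn_pt -> Prop
}.

Record subnormal_frame (F : sn_structure) : Prop := {
  sn_nonempty : inhabited F;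
  sn_poset : order F (@sn_le F);
  sn_Y0_upset : upset (@sn_le F) (@sn_Y0 F);
  sn_Y0_dense : forall x : F,
    (forall y, sn_le x y -> exists z, sn_le y z /\ sn_Y0 z) -> sn_Y0 x
}.

Record subnormal_identity_frame (F : sn_structure) : Prop := {
  sni_subnormal :> subnormal_frame F;
  sni_identity : forall x y : F,
    ~ sn_Y0 x -> ~ sn_Y0 y -> sn_le x y -> sn_le y x
}.

Record sc_J_frame (X : Type) (le RN : relation X) : Prop := {
  J_poset : order X le;
  J_down : forall x x' y y', le x x' -> RN x' y' -> le y y' -> RN x y;
  J_sym : symmetric X RN;
  J_condensed : forall x y, RN x y -> exists z, le x z /\ le y z /\ RN x z
}.

Record sc_H_frame (X : Type) (le RN : relation X) : Prop := {
  H_J :> sc_J_frame le RN;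
  H_refl : reflexive X RN
}.

Record nn_structure : Type := NnStructure {
  nn_pt :> Type;
  nn_le : relation nn_pt;
  nn_R1 : relation nn_pt;
  nn_R2 : relation nn_pt
}.

Record Nhat_frame (G : nn_structure) : Prop := {
  Nhat_H : sc_H_frame (@nn_le G) (@nn_R1 G);
  Nhat_J : sc_J_frame (@nn_le G) (@nn_R2 G);
  Nhat_link : forall x : G,
    (forall y, nn_R1 x y ->
       exists z, nn_R1 y z /\ ~ (exists z', nn_R2 z z')) ->
    ~ (exists z'', nn_R2 x z'')
}.

Record Nhat'_frame (G : nn_structure) : Prop := {
  Nhat'_Nhat :> Nhat_frame G;
  Nhat'_le : forall x y : G, nn_R2 x y -> nn_le y x
}.

Section Truth.
Variable V : Type.

Fixpoint sn_sat (F : sn_structure) (v : V -> F -> Prop) (x : F)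
    (a : formula V) : Prop :=
  match a with
  | Var p => v p x
  | Top => True
  | Bot => False
  | And a b => sn_sat v x a /\ sn_sat v x b
  | Or a b => sn_sat v x a \/ sn_sat v x b
  | Imp a b => forall y, sn_le x y -> sn_sat v y a -> sn_sat v y b
  | Neg a => forall y, sn_le x y -> ~ sn_sat v y a
  | Sim a => forall y, sn_le x y -> sn_sat v y a -> sn_Y0 y
  end.

Definition sn_true (F : sn_structure) (v : V -> F -> Prop) (a : formula V) : Prop :=
  forall x, sn_sat v x a.

Definition sn_valid (F : sn_structure) (a : formula V) : Prop :=
  forall v : V -> F -> Prop, valuation (@sn_le F) v -> sn_true v a.

Fixpoint nn_sat (G : nn_structure) (v : V -> G -> Prop) (x : G)
    (a : formula V) : Prop :=
  match a with
  | Var p => v p x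
  | Top => True
  | Bot => False
  | And a b => nn_sat v x a /\ nn_sat v x b
  | Or a b => nn_sat v x a \/ nn_sat v x b
  | Imp a b => forall y, nn_le x y -> nn_sat v y a -> nn_sat v y b
  | Neg a => forall y, nn_R1 x y -> ~ nn_sat v y a
  | Sim a => forall y, nn_R2 x y -> ~ nn_sat v y a
  end.

Definition nn_true (G : nn_structure) (v : V -> G -> Prop) (a : formula V) : Prop :=
  forall x, nn_sat v x a.

Definition nn_valid (G : nn_structure) (a : formula V) : Prop :=
  forall v : V -> G -> Prop, valuation (@nn_le G) v -> nn_true v a.

End Truth.

Definition Phi (F : sn_structure) : nn_structure := {|
  nn_pt := F;
  nn_le := @sn_le F;
  nn_R1 := fun x y => exists z, sn_le x z /\ sn_le y z;
  nn_R2 := fun x y => exists z, sn_le x z /\ sn_le y z /\ ~ sn_Y0 z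
|}.

(* Main.v *)
From Stdlib Require Import Relations Classical.
Require Import Defs.

(** Satisfaction on a sub-normal frame is persistent, so a witness [y] related
    to [x] may be pushed up to the common upper bound of [x] and [y] that
    defines the relations of [Phi F]; there the relational clauses for the two
    negations become the order clauses.  Classical logic is needed to recover
    membership in [sn_Y0] from the absence of [nn_R2]-successors. *)

Section Frame.
Variables (F : sn_structure) (HF : subnormal_frame F).

Let le_refl (x : F) : sn_le x x := ord_refl _ _ (sn_poset HF) x.

Let le_trans (x y z : F) : sn_le x y -> sn_le y z -> sn_le x z :=
  ord_trans _ _ (sn_poset HF) x y z.

Lemma Y0_iff_no_R2 (x : F) : sn_Y0 x <-> ~ exists y, @nn_R2 (Phi F) x y.
Proof.
split.
- intros Yx [y [z [xz [_ nYz]]]]; exact (nYz (sn_Y0_upset HF xz Yx)).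
- intros noR; apply NNPP; intros nYx; apply noR.
  (* A point outside [sn_Y0] is its own [nn_R2]-successor, with itself as upper bound. *)
  exists x, x; auto.
Qed.

Lemma Phi_R1_H_frame : sc_H_frame (@nn_le (Phi F)) (@nn_R1 (Phi F)).
Proof.
split; [split|].
- exact (sn_poset HF).
- intros x x' y y' xx' [z [x'z y'z]] yy'; exists z; eauto.
- intros x y [z [xz yz]]; exists z; auto.
- intros x y [z [xz yz]]; exists z; repeat split; auto; exists z; auto.
- intros x; exists x; auto.
Qed.

Lemma Phi_R2_J_frame : sc_J_frame (@nn_le (Phi F)) (@nn_R2 (Phi F)).
Proof.
split.
- exact (sn_poset HF).
- intros x x' y y' xx' [z [x'z [y'z nYz]]] yy'; exists z; eauto.
- intros x y [z [xz [yz nYz]]]; exists z; auto.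
- intros x y [z [xz [yz nYz]]]; exists z; repeat split; auto; exists z; auto.
Qed.

(** The link condition reduces to density of [sn_Y0]: a point [z] without [nn_R2]-successors lies in
    [sn_Y0], and so does the common upper bound [w] of [y] and [z], which is the point above [y]
    that density asks for. *)
Lemma Phi_Nhat_frame : Nhat_frame (Phi F).
Proof.
split; [exact Phi_R1_H_frame | exact Phi_R2_J_frame |].
intros x dense; apply Y0_iff_no_R2, (sn_Y0_dense HF); intros y xy.
destruct (dense y) as [z [[w [yw zw]] noRz]].
- exists y; auto.
- exists w; split; [exact yw|].
  exact (sn_Y0_upset HF zw (proj2 (Y0_iff_no_R2 z) noRz)).
Qed.

(** Since [x] lies below a bound [z] outside the upset [sn_Y0], it is outside too; the identity
    condition then reverses [x <= z], giving [y <= z <= x]. *)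
Lemma Phi_Nhat'_frame : subnormal_identity_frame F -> Nhat'_frame (Phi F).
Proof.
intros HI; split; [exact Phi_Nhat_frame|].
intros x y [z [xz [yz nYz]]].
apply (le_trans _ z); [exact yz|].
apply (sni_identity HI); auto.
intros Yx; exact (nYz (sn_Y0_upset HF xz Yx)).
Qed.

Variables (V : Type) (v : V -> F -> Prop) (Hv : valuation (@sn_le F) v).

Lemma sn_sat_upset (a : formula V) :
  upset (@sn_le F) (fun x => sn_sat v x a).
Proof.
induction a; intros x y xy; simpl; eauto.
- exact (Hv p x y xy).
- intros [Ha Hb]; split; eauto.
- intros [Ha | Hb]; [left | right]; eauto.
Qed.

Lemma sn_sat_Phi (a : formula V) (x : F) :
  sn_sat v x a <-> @nn_sat V (Phi F) v x a.
Proof.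
revert x; induction a as [p| | |a IHa b IHb|a IHa b IHb|a IHa b IHb|a IHa|a IHa];
  intros x; simpl; try tauto.
- rewrite IHa, IHb; tauto.
- rewrite IHa, IHb; tauto.
- split; intros H y xy ay; apply IHb, (H y xy), IHa, ay.
- split.
  + intros H y [z [xz yz]] ay.
    exact (H z xz (sn_sat_upset a y z yz (proj2 (IHa y) ay))).
  + intros H y xy ay; apply (H y); [exists y; auto | apply IHa, ay].
- split.
  + intros H y [z [xz [yz nYz]]] ay.
    exact (nYz (H z xz (sn_sat_upset a y z yz (proj2 (IHa y) ay)))).
  (* If [y] were outside [sn_Y0], it would itself be the bound making [x] and [y] related by
     [nn_R2]. *)
  + intros H y xy ay; apply NNPP; intros nYy.
    apply (H y); [exists y; auto | apply IHa, ay].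
Qed.

Lemma sn_true_Phi (a : formula V) : sn_true v a <-> @nn_true V (Phi F) v a.
Proof. split; intros H x; apply sn_sat_Phi, H. Qed.

End Frame.

Theorem theorem5p4 (V : Type) (F : sn_structure) (HF : subnormal_frame F) :
  (forall z : F, sn_Y0 z <-> ~ (exists x : F, @nn_R2 (Phi F) z x))
  /\ (Nhat_frame (Phi F)
      /\ (subnormal_identity_frame F -> Nhat'_frame (Phi F)))
  /\ (forall v : V -> F -> Prop, valuation (@sn_le F) v ->
        valuation (@nn_le (Phi F)) v
        /\ forall a : formula V,
             (forall x : F, @sn_sat V F v x a <-> @nn_sat V (Phi F) v x a)
             /\ (@sn_true V F v a <-> @nn_true V (Phi F) v a)
             /\ (sn_valid F a <-> nn_valid (Phi F) a)).
Proof.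
split; [exact (Y0_iff_no_R2 F HF)|].
split; [exact (conj (Phi_Nhat_frame F HF) (Phi_Nhat'_frame F HF))|].
intros v Hv; split; [exact Hv|]; intros a.
split; [exact (sn_sat_Phi F HF V v Hv a)|].
split; [exact (sn_true_Phi F HF V v Hv a)|].
(* Both frames share their order, hence their valuations, so the equivalence of truth applies to
   each [w]. *)
split; intros H w Hw; apply (sn_true_Phi F HF V w Hw), H, Hw.
Qed.
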